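(* Let $\beta,\varepsilon\in(0,\infty)$, $h_0\in\mathbb{R}$ and $N\ge2$. There is a function $\lambda_N(\eta_{[2,N]})$ (real-valued, of $\eta_{[2,N]}\in\{-1,1\}^{N-1}$), depending on the parameters $\beta,\varepsilon,h_0$, which is invariant under permutations of $(\eta_i)_{i=2,\dots,N}$, such that $$\sum_{\sigma_1=\pm1}K_{\beta,\varepsilon,h_0,N}(\sigma_1)\,\sigma_1=\sum_{\sigma_{[2,N]},\eta_{[2,N]}}K_{\beta,\varepsilon,h_0,N}(\sigma_{[2,N]},\eta_{[2,N]})\Biggl(\sum_{\sigma_1=\pm1}\pi_{\lambda_N(\eta_{[2,N]});\beta,\varepsilon,h_0}\Bigl[\frac1N\sum_{i=2}^N\sigma_i\Bigr](\sigma_1)\,\sigma_1\Biggr)$$ and $$0=\sum_{\sigma_{[2,N]},\eta_{[2,N]}}K_{\beta,\varepsilon,h_0,N}(\sigma_{[2,N]},\eta_{[2,N]})\Biggl(\sum_{\eta_1=\pm1}\pi_{\lambda_N(\eta_{[2,N]});\beta,\varepsilon,h_0}\Bigl[\frac1N\sum_{i=2}^N\sigma_i\Bigr](\eta_1)\,\eta_1\Biggr).$$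
   Context: Spins $\sigma_i$ and random fields $\eta_i$ take values in $\{-1,+1\}$. The quenched measure of the mean-field random field Ising model for fixed $\eta_{[1,N]}=(\eta_1,\dots,\eta_N)$ is $$\mu_{\beta,\varepsilon,h_0,N}[\eta_{[1,N]}](\sigma_{[1,N]}):=\frac{\exp\Bigl(\frac{\beta}{2N}\bigl(\sum_{i=1}^N\sigma_i\bigr)^2+\beta\sum_{i=1}^N(\varepsilon\eta_i+h_0)\sigma_i\Bigr)}{Z_{\beta,\varepsilon,h_0,N}[\eta_{[1,N]}]},$$ where $Z_{\beta,\varepsilon,h_0,N}[\eta_{[1,N]}]$ is the sum of the numerator over $\sigma_{[1,N]}\in\{-1,1\}^N$. The true joint measure on $\{-1,1\}^N\times\{-1,1\}^N$ is $$K_{\beta,\varepsilon,h_0,N}(\sigma_{[1,N]},\eta_{[1,N]})=\frac1{2^N}\mu_{\beta,\varepsilon,h_0,N}[\eta_{[1,N]}](\sigma_{[1,N]}).$$ $K_{\beta,\varepsilon,h_0,N}(\sigma_1)$ and $K_{\beta,\varepsilon,h_0,N}(\sigma_{[2,N]},\eta_{[2,N]})$ denote its marginals on $\sigma_1$ and on $(\sigma_i,\eta_i)_{i=2,\dots,N}$. For $m,\lambda\in\mathbb{R}$ the single-site probability measure $\pi_{\lambda;\beta,\varepsilon,h_0}[m]$ on $\{-1,1\}^2$ is $$\pi_{\lambda;\beta,\varepsilon,h_0}[m](\sigma_1,\eta_1):=\frac{\exp\bigl(\beta(m+\varepsilon\eta_1+h_0)\sigma_1+\lambda\eta_1\bigr)}{2\sum_{k=\pm1}\cosh(\beta(m+\varepsilon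 k+h_0))e^{\lambda k}},$$ and $\pi_{\lambda;\beta,\varepsilon,h_0}[m](\sigma_1)$, $\pi_{\lambda;\beta,\varepsilon,h_0}[m](\eta_1)$ denote its marginals. *)

(* Defs.v *)
From mathcomp Require Import all_boot all_order all_algebra perm.
From mathcomp Require Import reals sequences exp.
Set Implicit Arguments.
Unset Strict Implicit.
Unset Printing Implicit Defensive.
Import Order.TTheory GRing.Theory Num.Theory.
Local Open Scope ring_scope.

(* [true] encodes +1 and [false] encodes -1. *)
Definition spin : finType := bool.

Definition spin_val (R : realType) (s : spin) : R := if s then 1 else -1.

(* Spins or fields on n sites. For N = n.+1 sites, the site 1 of the model is
   [ord0], and the site i.+2 is [lift ord0 i] for i : 'I_n. *)
Definition config (n : nat) : finType := {ffun 'I_n -> spin}.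

(* The restriction of a configuration from the sites [1, N] to [2, N]. *)
Definition tail_config (n : nat) (c : config n.+1) : config n :=
  [ffun i => c (lift ord0 i)].

Definition total_spin (R : realType) (n : nat) (sigma : config n) : R :=
  \sum_(i < n) spin_val R (sigma i).

Definition gibbs_weight (R : realType) (beta eps h0 : R) (N : nat)
    (eta sigma : config N) : R :=
  expR (beta / (2 * N%:R) * total_spin R sigma ^+ 2
        + beta * \sum_(i < N)
            (eps * spin_val R (eta i) + h0) * spin_val R (sigma i)).

Definition partition_function (R : realType) (beta eps h0 : R) (N : nat)
    (eta : config N) : R :=
  \sum_(sigma : config N) gibbs_weight beta eps h0 eta sigma.

Definition quenched_measure (R : realType) (beta eps h0 : R) (N : nat)
    (eta sigma : config N) : R :=
  gibbs_weight beta eps h0 eta sigma / partition_function beta eps h0 eta.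

Definition joint_measure (R : realType) (beta eps h0 : R) (N : nat)
    (sigma eta : config N) : R :=
  1 / 2 ^+ N * quenched_measure beta eps h0 eta sigma.

Definition joint_spin1 (R : realType) (beta eps h0 : R) (n : nat)
    (s : spin) : R :=
  \sum_(sigma : config n.+1 | sigma ord0 == s) \sum_(eta : config n.+1)
    joint_measure beta eps h0 sigma eta.

Definition joint_tail (R : realType) (beta eps h0 : R) (n : nat)
    (sigma' eta' : config n) : R :=
  \sum_(sigma : config n.+1 | tail_config sigma == sigma')
  \sum_(eta : config n.+1 | tail_config eta == eta')
    joint_measure beta eps h0 sigma eta.

Definition cosh (R : realType) (x : R) : R := (expR x + expR (- x)) / 2.

Definition single_site (R : realType) (lambda beta eps h0 m : R)
    (s e : spin) : R :=
  expR (beta * (m + eps * spin_val R e + h0) * spin_val R s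
        + lambda * spin_val R e)
  / (2 * \sum_(k : spin) cosh (beta * (m + eps * spin_val R k + h0))
                         * expR (lambda * spin_val R k)).

Definition single_site_spin (R : realType) (lambda beta eps h0 m : R)
    (s : spin) : R :=
  \sum_(e : spin) single_site lambda beta eps h0 m s e.

Definition single_site_field (R : realType) (lambda beta eps h0 m : R)
    (e : spin) : R :=
  \sum_(s : spin) single_site lambda beta eps h0 m s e.

Definition perm_invariant (R : realType) (n : nat) (f : config n -> R) : Prop :=
  forall (p : 'S_n) (c : config n), f [ffun i => c (p i)] = f c.

(* Main.v *)
Require Import Defs.
From mathcomp Require Import all_boot all_order all_algebra perm.
From mathcomp Require Import ring.
From mathcomp Require Import reals sequences exp.
Set Implicit Arguments.
Unset Strict Implicit.
Unset Printing Implicit Defensive.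
Import Order.TTheory GRing.Theory Num.Theory.
Local Open Scope ring_scope.

(** Under the joint measure, the conditional weight of the pair (sigma_1, eta_1)
    given the other sites is proportional to
    exp(beta (m + eps eta_1 + h0) sigma_1) / Z[eta_1, eta_[2,N]].
    As eta_1 takes only two values, 1 / Z[eta_1, eta_[2,N]] can be written as
    exp(lambda eta_1) / C with lambda = (ln Z[-1, .] - ln Z[+1, .]) / 2.
    With this lambda, pi_lambda[m] is the conditional law of (sigma_1, eta_1)
    given the other sites, and both identities are instances of total
    expectation, the second one because eta_1 is centred. *)

(** * Splitting a configuration into site 1 and the remaining sites *)

Definition config_cons (n : nat) (s : spin) (c : config n) : config n.+1 :=
  [ffun i => oapp c s (unlift ord0 i)].

Lemma config_cons0 (n : nat) (s : spin) (c : config n) :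
  config_cons s c ord0 = s.
Proof. by rewrite ffunE unlift_none. Qed.

Lemma config_consS (n : nat) (s : spin) (c : config n) (i : 'I_n) :
  config_cons s c (lift ord0 i) = c i.
Proof. by rewrite ffunE liftK. Qed.

Lemma tail_config_cons (n : nat) (s : spin) (c : config n) :
  tail_config (config_cons s c) = c.
Proof. by apply/ffunP=> i; rewrite ffunE config_consS. Qed.

Lemma config_cons_tail (n : nat) (c : config n.+1) :
  config_cons (c ord0) (tail_config c) = c.
Proof.
apply/ffunP=> i; rewrite ffunE.
by case: unliftP => [j|] ->; rewrite //= ffunE.
Qed.

Lemma sum_config_cons (V : nmodType) (n : nat) (P : pred (config n.+1))
    (F : config n.+1 -> V) :
  \sum_(c | P c) F c
  = \sum_(s : spin) \sum_(c : config n | P (config_cons s c))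
      F (config_cons s c).
Proof.
rewrite pair_big_dep /=.
rewrite (reindex (fun sc : spin * config n => config_cons sc.1 sc.2)) //.
exists (fun c : config n.+1 => (c ord0, tail_config c)) => [[s c] _ | c _] /=.
  by rewrite config_cons0 tail_config_cons.
exact: config_cons_tail.
Qed.

Lemma total_spin_cons (R : realType) (n : nat) (s : spin) (c : config n) :
  total_spin R (config_cons s c) = spin_val R s + total_spin R c.
Proof.
rewrite /total_spin big_ord_recl config_cons0; congr (_ + _).
by apply: eq_bigr => i _; rewrite config_consS.
Qed.

Lemma spin_val_sqr (R : realType) (s : spin) : spin_val R s ^+ 2 = 1.
Proof. by case: s; rewrite /= ?sqrrN expr1n. Qed.

(** * Positivity and permutation symmetry of the partition function *)

Section Model.
Variables (R : realType) (beta eps h0 : R).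

Lemma gibbs_weight_gt0 (N : nat) (eta sigma : config N) :
  0 < gibbs_weight beta eps h0 eta sigma.
Proof. exact: expR_gt0. Qed.

Lemma partition_function_gt0 (N : nat) (eta : config N) :
  0 < partition_function beta eps h0 eta.
Proof.
(* Positivity needs one summand; [eta] itself serves as a spin configuration. *)
rewrite /partition_function (bigD1 eta) //=.
by rewrite ltr_wpDr ?sumr_ge0 ?gibbs_weight_gt0// => s _;
  apply/ltW/gibbs_weight_gt0.
Qed.

Lemma sum_quenched_measure (N : nat) (eta : config N) :
  \sum_(sigma : config N) quenched_measure beta eps h0 eta sigma = 1.
Proof.
by rewrite -mulr_suml divff // gt_eqF // partition_function_gt0.
Qed.

(** The exponent involves only sums over sites, so relabelling fields and spins by the same
    permutation just reindexes them. *)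
Lemma gibbs_weight_perm (N : nat) (q : 'S_N) (eta sigma : config N) :
  gibbs_weight beta eps h0 [ffun i => eta (q i)] [ffun i => sigma (q i)]
  = gibbs_weight beta eps h0 eta sigma.
Proof.
rewrite /gibbs_weight /total_spin; congr (expR (_ * _ ^+ 2 + _ * _)).
  rewrite [RHS](reindex_inj (@perm_inj _ q)).
  by apply: eq_bigr => i _; rewrite ffunE.
rewrite [RHS](reindex_inj (@perm_inj _ q)).
by apply: eq_bigr => i _; rewrite !ffunE.
Qed.

Lemma partition_function_perm (N : nat) (q : 'S_N) (eta : config N) :
  partition_function beta eps h0 [ffun i => eta (q i)]
  = partition_function beta eps h0 eta.
Proof.
rewrite /partition_function.
rewrite (reindex (fun c : config N => [ffun i => c (q i)] : config N)).
  by apply: eq_bigr => c _; rewrite gibbs_weight_perm.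
exists (fun c : config N => [ffun i => c ((q^-1)%g i)]) => c _;
  by apply/ffunP=> i; rewrite !ffunE ?permK ?permKV.
Qed.

(** A permutation of the sites 2 to N extends to all sites by fixing site 1, which reduces this to
    full symmetry. *)
Lemma partition_function_cons_perm (n : nat) (e : spin) (p : 'S_n)
    (eta : config n) :
  partition_function beta eps h0 (config_cons e [ffun i => eta (p i)])
  = partition_function beta eps h0 (config_cons e eta).
Proof.
rewrite -(partition_function_perm (lift_perm ord0 ord0 p) (config_cons e eta)).
congr partition_function; apply/ffunP=> i; rewrite [RHS]ffunE.
case: (unliftP ord0 i) => [j|] ->.
  by rewrite lift_perm_lift !config_consS ffunE.
by rewrite lift_perm_id !config_cons0.
Qed.

(** * The tilt that replaces the partition function *)

Definition tilt (n : nat) (eta : config n) : R :=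
  (ln (partition_function beta eps h0 (config_cons false eta))
   - ln (partition_function beta eps h0 (config_cons true eta))) / 2.

Lemma tilt_perm_invariant (n : nat) : perm_invariant (@tilt n).
Proof. by move=> p c; rewrite /tilt !partition_function_cons_perm. Qed.

(** The right-hand side is the geometric mean of the two partition functions. What matters is that
    it does not depend on [e]. *)
Lemma expR_tiltM (n : nat) (eta : config n) (e : spin) :
  expR (tilt eta * spin_val R e)
    * partition_function beta eps h0 (config_cons e eta)
  = expR ((ln (partition_function beta eps h0 (config_cons false eta))
           + ln (partition_function beta eps h0 (config_cons true eta))) / 2).
Proof.
rewrite -[X in _ * X]lnK ?posrE ?partition_function_gt0// -expRD.
by congr expR; rewrite /tilt; case: e => /=; field.
Qed.

(** * The conditional law of site 1 *)

Definition site_weight (lambda m : R) (s e : spin) : R :=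
  expR (beta * (m + eps * spin_val R e + h0) * spin_val R s
        + lambda * spin_val R e).

Lemma single_siteE (lambda m : R) (s e : spin) :
  single_site lambda beta eps h0 m s e
  = site_weight lambda m s e
    / \sum_(s' : spin) \sum_(e' : spin) site_weight lambda m s' e'.
Proof.
rewrite /single_site; congr (_ / _).
rewrite exchange_big mulr_sumr; apply: eq_bigr => k _.
rewrite big_bool /site_weight !expRD /cosh /= mulr1 mulrN1.
by field.
Qed.

(** Since the squared spin is 1, expanding the squared total spin leaves only its cross term
    depending on [s], and that term is the mean field acting on site 1. All else, apart from the
    field term of site 1, goes into [w], which is independent of [s] and [e]. *)
Lemma gibbs_weight_cons (n : nat) (sigma eta : config n) :
  exists w : R, forall s e,
    gibbs_weight beta eps h0 (config_cons e eta) (config_cons s sigma)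
    = w * site_weight 0 (1 / n.+1%:R * total_spin R sigma) s e.
Proof.
exists (expR (beta / (2 * n.+1%:R) * (1 + total_spin R sigma ^+ 2)
  + beta * \sum_(i < n) (eps * spin_val R (eta i) + h0) * spin_val R (sigma i))).
move=> s e; rewrite /gibbs_weight /site_weight -expRD; congr expR.
rewrite total_spin_cons big_ord_recl !config_cons0.
under eq_bigr do rewrite !config_consS.
rewrite sqrrD spin_val_sqr.
by field; rewrite nat1r pnatr_eq0.
Qed.

(** By [expR_tiltM], dividing by the partition function amounts to multiplying by the tilt factor
    and dividing by a constant common to both values of [e]. *)
Lemma joint_measure_cons (n : nat) (sigma eta : config n) :
  exists a : R, forall s e,
    joint_measure beta eps h0 (config_cons s sigma) (config_cons e eta)
    = a * site_weight (tilt eta) (1 / n.+1%:R * total_spin R sigma) s e.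
Proof.
have [w wE] := gibbs_weight_cons sigma eta.
set C := expR ((ln (partition_function beta eps h0 (config_cons false eta))
  + ln (partition_function beta eps h0 (config_cons true eta))) / 2).
exists (1 / 2 ^+ n.+1 * w / C) => s e.
rewrite /joint_measure /quenched_measure wE /site_weight mul0r addr0 expRD.
rewrite /C -(expR_tiltM eta e).
have Z0 := lt0r_neq0 (partition_function_gt0 (config_cons e eta)).
have E0 := lt0r_neq0 (expR_gt0 (tilt eta * spin_val R e)).
by field; rewrite Z0 E0 expf_neq0 // pnatr_eq0.
Qed.

Lemma joint_tailE (n : nat) (sigma eta : config n) :
  joint_tail beta eps h0 sigma eta
  = \sum_(s : spin) \sum_(e : spin)
      joint_measure beta eps h0 (config_cons s sigma) (config_cons e eta).
Proof.
rewrite /joint_tail sum_config_cons; apply: eq_bigr => s _.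
rewrite (big_pred1 sigma) => [|c]; last by rewrite tail_config_cons.
rewrite sum_config_cons; apply: eq_bigr => e _.
by rewrite (big_pred1 eta) => [//|c]; rewrite tail_config_cons.
Qed.

(** The tail marginal is [a] times the normalisation of [single_site], so the normalisation cancels
    and only [a] times the site weight is left. *)
Lemma joint_tail_single_site (n : nat) (sigma eta : config n) (s e : spin) :
  joint_tail beta eps h0 sigma eta
    * single_site (tilt eta) beta eps h0
        (1 / n.+1%:R * total_spin R sigma) s e
  = joint_measure beta eps h0 (config_cons s sigma) (config_cons e eta).
Proof.
have [a aE] := joint_measure_cons sigma eta.
rewrite joint_tailE single_siteE.
under eq_bigr do under eq_bigr do rewrite aE.
under eq_bigr do rewrite -mulr_sumr.
rewrite -mulr_sumr aE mulrACA mulrCA [_ * (_ / _)]mulrC.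
set D := \sum_(_ : spin) _.
suff D0 : D != 0 by field.
rewrite /D !big_bool gt_eqF // !addr_gt0 //; exact: expR_gt0.
Qed.

Lemma joint_tail_spin (n : nat) (sigma eta : config n) :
  joint_tail beta eps h0 sigma eta
    * (\sum_(s : spin)
         single_site_spin (tilt eta) beta eps h0
           (1 / n.+1%:R * total_spin R sigma) s * spin_val R s)
  = \sum_(s : spin) \sum_(e : spin)
      joint_measure beta eps h0 (config_cons s sigma) (config_cons e eta)
      * spin_val R s.
Proof.
rewrite mulr_sumr; apply: eq_bigr => s _.
rewrite mulrA mulr_sumr mulr_suml; apply: eq_bigr => e _.
by rewrite joint_tail_single_site.
Qed.

Lemma joint_tail_field (n : nat) (sigma eta : config n) :
  joint_tail beta eps h0 sigma eta
    * (\sum_(e : spin)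
         single_site_field (tilt eta) beta eps h0
           (1 / n.+1%:R * total_spin R sigma) e * spin_val R e)
  = \sum_(e : spin) \sum_(s : spin)
      joint_measure beta eps h0 (config_cons s sigma) (config_cons e eta)
      * spin_val R e.
Proof.
rewrite mulr_sumr; apply: eq_bigr => e _.
rewrite mulrA mulr_sumr mulr_suml; apply: eq_bigr => s _.
by rewrite joint_tail_single_site.
Qed.

(** The fields are uniformly distributed under the joint measure; this is what centres the field at
    site 1. *)
Lemma sum_joint_measure (N : nat) (eta : config N) :
  \sum_(sigma : config N) joint_measure beta eps h0 sigma eta = 1 / 2 ^+ N.
Proof. by rewrite -mulr_sumr sum_quenched_measure mulr1. Qed.

End Model.

(* The number of sites is N = n.+1. *)
Theorem proposition3p1 (R : realType) (beta eps h0 : R) (n : nat)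
    (hbeta : 0 < beta) (heps : 0 < eps) (hN : (2 <= n.+1)%N) :
  exists lambda : config n -> R,
    [/\ perm_invariant lambda,
        \sum_(s : spin) joint_spin1 beta eps h0 n s * spin_val R s
        = \sum_(sigma : config n) \sum_(eta : config n)
            joint_tail beta eps h0 sigma eta
            * (\sum_(s : spin)
                 single_site_spin (lambda eta) beta eps h0
                   (1 / n.+1%:R * total_spin R sigma) s * spin_val R s)
      & 0
        = \sum_(sigma : config n) \sum_(eta : config n)
            joint_tail beta eps h0 sigma eta
            * (\sum_(e : spin)
                 single_site_field (lambda eta) beta eps h0
                   (1 / n.+1%:R * total_spin R sigma) e * spin_val R e)].
Proof.
exists (@tilt R beta eps h0 n); split; first exact: tilt_perm_invariant.
- under [RHS]eq_bigr do (under eq_bigr do rewrite joint_tail_spin;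
    rewrite exchange_big /=).
  rewrite [RHS]exchange_big /=; apply: eq_bigr => s _.
  (* Splitting off site 1 gives a sum over its spin value; the constraint in [joint_spin1] kills
     every value other than [s]. *)
  rewrite /joint_spin1 sum_config_cons (bigD1 s) //= addrC big1 ?add0r.
    rewrite mulr_suml.
    apply: eq_big => [c|sigma _]; first by rewrite config_cons0 eqxx.
    rewrite sum_config_cons exchange_big mulr_suml.
    by apply: eq_bigr => eta _; rewrite mulr_suml.
  by move=> s' /negbTE s's; rewrite big_pred0 // => c; rewrite config_cons0.
- under [RHS]eq_bigr do (under eq_bigr do rewrite joint_tail_field;
    rewrite exchange_big /=).
  rewrite [RHS]exchange_big /=.
  (* For a fixed field at site 1, summing out all spins leaves the uniform weight. The values for
     the two signs of [e] then cancel term by term in [eta]. *)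
  suff eE (e : spin) : \sum_(sigma : config n) \sum_(eta : config n)
      \sum_(s : spin) joint_measure beta eps h0
        (config_cons s sigma) (config_cons e eta) * spin_val R e
      = \sum_(eta : config n) 1 / 2 ^+ n.+1 * spin_val R e.
    rewrite big_bool /= !eE -big_split big1 // => eta _.
    by rewrite /= mulrN1 mulr1 subrr.
  rewrite exchange_big; apply: eq_bigr => eta _.
  rewrite exchange_big -(sum_joint_measure beta eps h0 (config_cons e eta)).
  by rewrite sum_config_cons mulr_suml; apply: eq_bigr => s _; rewrite mulr_suml.
Qed.
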